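(* Let $\mathcal C$ be an $N$-dimensional asymptotic class of finite $L$-structures, and let $\mathcal D$ be a class of finite $L'$-structures uniformly parameter-interpretable in $\mathcal C$ by an interpretation $\mathcal I$ of arity $r$. Assume: (i) every cell $\chi_{e,\lambda}(\bar z)$ in the fixed ambient quotient-universe partition has a parameter-free pullback to $\mathcal D$, i.e. there is a parameter-free $L'$-sentence $\chi^{\downarrow}$ with $A\models\chi^{\downarrow}\iff\alpha(A)\models\chi_{e,\lambda}(\bar c_A)$ for all $A\in\mathcal D$; (ii) for each $L'$-formula $\varphi(x;\bar y)$ with one object variable, one can choose an ambient quotient-counting partition for $\varphi$ such that every invariant profile of its parameter cells has a parameter-free pullback to $\mathcal D$, i.e. for every nonempty set $P$ of cell indices there is a parameter-free $L'$-formula $\gamma_P(\bar y)$ defining in every $A\in\mathcal D$ the set of tuples $\bar b$ whose profile is $P$. Then $\mathcal D$ is an $L_Q$-dimensional asymptotic class.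
   Context: Conventions. Languages $L,L'$ are countable first-order languages, possibly with finitely many sorts; function and constant symbols may be replaced by graph relations. All structures in the classes considered are finite, and $|M|$ is the total number of elements (summed over sorts). Uniform little-$o$. For a collection $\Phi$ (a ''cell'') of pairs $(M,\bar a)$, $f=o(g)$ uniformly on $\Phi$ means: for every $\varepsilon>0$ there is $Q$ with $|f(M,\bar a)|\le\varepsilon g(M,\bar a)$ for all $(M,\bar a)\in\Phi$ with $|M|>Q$. $N$-dimensional asymptotic class ($N\ge1$). A class $\mathcal C$ of finite $L$-structures such that for every $L$-formula $\varphi(x;\bar y)$ with a single object variable $x$ there are a finite set $D_\varphi\subseteq(\{0,\dots,N\}\times\mathbb R_{>0})\cup\{(0,0)\}$ and, for each $(d,\mu)\in D_\varphi$, a parameter-free $L$-formula $\theta_{d,\mu}(\bar y)$ such that in every $M\in\mathcal C$ the sets $\theta_{d,\mu}(M^{|\bar y|})$ partition $M^{|\bar y|}$, and, uniformly on the cell $\{(M,\bar a):M\models\theta_{d,\mu}(\bar a)\}$, $|\varphi(M;\bar a)|=\mu|M|^{d/N}+o(|M|^{d/N})$; for $(0,0)$ this means $|\varphi(M;\bar a)|=o(1)$. Uniform parameter-interpretation $\mathcal I$ of $\mathcal D$ in $\mathcal C$, of arity $r\ge1$: an injection $\alpha:\mathcal D\to\mathcal C$; an integer $s\ge0$; fixed $L$-formulas $\delta(\bar u;\bar z)$, $\epsilon(\bar u,\bar v;\bar z)$ with $|\bar u|=|\bar v|=r$, $|\bar z|=s$; for each relation symbol $R\in L'$ a fixed $L$-formula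 $R^{\mathcal I}$ on the appropriate number of $r$-tuples (and $\bar z$); and for each $A\in\mathcal D$ a tuple $\bar c_A\in\alpha(A)^s$ and an $L'$-isomorphism $\iota_A:A\to X_A/E_A$, where $X_A=\delta(\alpha(A)^r;\bar c_A)$ and $E_A$ is the equivalence relation on $X_A$ defined by $\epsilon(\bar u,\bar v;\bar c_A)$; the formulas $R^{\mathcal I}$ (evaluated at $\bar c_A$) are $E_A$-invariant on $X_A$ and induce the $L'$-structure on $X_A/E_A$. A representative of $a\in A$ is an element of the class $\iota_A(a)$. Quotient-universe partition and $L_Q$. There is a finite family of parameter-free $L$-formulas $\chi_{e,\lambda}(\bar z)$, indexed by pairs $(e,\lambda)\in(\{0,\dots,Nr\}\times\mathbb R_{>0})\cup\{(0,0)\}$, such that for each $A\in\mathcal D$ exactly one $\chi_{e,\lambda}(\bar c_A)$ holds in $M=\alpha(A)$, and uniformly on each cell $|A|=|X_A/E_A|=\lambda|M|^{e/N}+o(|M|^{e/N})$ (as $|M|\to\infty$). Fix such a partition. Let $\mathscr E_Q$ be the set of positive $e$ for which, for some $\lambda>0$, the structures $A\in\mathcal D$ with $\alpha(A)\models\chi_{e,\lambda}(\bar c_A)$ have unbounded cardinality. Then $L_Q=\operatorname{lcm}(\mathscr E_Q)$, with $\operatorname{lcm}(\varnothing)=1$. Ambient quotient-counting partition for an $L'$-formula $\varphi(x;y_1,\dots,y_m)$: finitely many parameter-free $L$-formulas $\theta_i(\bar v_1,\dots,\bar v_m;\bar z)$, $i\in I$, with labels $(d_i,\mu_i)\in(\{0,\dots,Nr\}\times\mathbb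 R_{>0})\cup\{(0,0)\}$, such that for each $A\in\mathcal D$ the formulas $\theta_i(\cdot;\bar c_A)$ partition $X_A^m$ and, uniformly over all $A\in\mathcal D$ and $\bar b\in A^m$ having a representative tuple $\bar v\in X_A^m$ with $\alpha(A)\models\theta_i(\bar v;\bar c_A)$, $|\varphi(A;\bar b)|=\mu_i|M|^{d_i/N}+o(|M|^{d_i/N})$, $M=\alpha(A)$ (meaning $o(1)$ for label $(0,0)$). (Such partitions always exist.) The cells need not be invariant under changing representatives. The profile of $\bar b\in A^m$ is the nonempty set of all $i\in I$ such that some representative tuple $\bar v\in X_A^m$ of $\bar b$ satisfies $\theta_i(\bar v;\bar c_A)$ in $\alpha(A)$. *)

(* Defs.v *)
From mathcomp Require Import all_boot all_order all_algebra finmap.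
From mathcomp Require Import all_classical all_reals all_analysis.

Set Implicit Arguments.
Unset Strict Implicit.
Unset Printing Implicit Defensive.

Import Order.TTheory GRing.Theory Num.Theory.

Local Open Scope classical_set_scope.
Local Open Scope fset_scope.
Local Open Scope ring_scope.

(* Countable languages with finitely many sorts.  Function and constant symbols
   are represented by their graph relations, so only relation symbols occur;
   lsig P lists the sorts of the arguments of P. *)
Record language := Language {
  lsort : finType;
  lrel : countType;
  lsig : lrel -> seq lsort }.
Arguments lsig {l} _.

Definition arity (L : language) (P : lrel L) : nat := size (lsig P).

(* The carrier is the total universe, i.e. the disjoint union of the sorts, so
   that struct_card M is the number of elements summed over sorts. *)
Record structure (L : language) := Structure {
  carrier :> finType;
  sort_of : carrier -> lsort L;
  holds : forall P : lrel L, pred ((arity P).-tuple carrier);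
  holds_sorted : forall (P : lrel L) (v : (arity P).-tuple carrier),
    holds v -> map sort_of v = lsig P }.
Arguments holds {L} _ _ _.

Definition struct_card (L : language) (M : structure L) : nat := #|{: M}|.

Definition class (L : language) := structure L -> Prop.

Definition member (L : language) (C : class L) : Type := {M : structure L | C M}.

Definition member_structure (L : language) (C : class L) (M : member C) :
  structure L := proj1_sig M.
Coercion member_structure : member >-> structure.

(* formula L n: formulas whose free variables are among x_0, ..., x_(n-1).
   Variables range over the total universe and FSort s i says that x_i has
   sort s, so a quantifier over the sort s is a quantifier relativized to
   FSort s.  FEx binds x_0 and shifts the other variables. *)
Inductive formula (L : language) : nat -> Type :=
| FBot n : formula L n
| FEq n (i j : 'I_n) : formula L n
| FSort n (s : lsort L) (i : 'I_n) : formula L n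
| FRel n (P : lrel L) (i : (arity P).-tuple 'I_n) : formula L n
| FNot n (f : formula L n) : formula L n
| FAnd n (f g : formula L n) : formula L n
| FEx n (f : formula L n.+1) : formula L n.

Fixpoint sat (L : language) (M : structure L) n (f : formula L n) :
    n.-tuple M -> bool :=
  match f in formula _ n return n.-tuple M -> bool with
  | FBot _ => fun=> false
  | FEq _ i j => fun a => tnth a i == tnth a j
  | FSort _ s i => fun a => sort_of (tnth a i) == s
  | FRel _ P i => fun a => holds M P (map_tuple (tnth a) i)
  | FNot _ g => fun a => ~~ sat g a
  | FAnd _ g h => fun a => sat g a && sat h a
  | FEx _ g => fun a => [exists x : M, sat g [tuple of x :: a]]
  end.

(* |phi(M; a)|, the object variable being x_0. *)
Definition count_sat (L : language) (M : structure L) n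
    (phi : formula L n.+1) (a : n.-tuple M) : nat :=
  #|[set x : M | sat phi [tuple of x :: a]]%SET|.

(* f = o(g) uniformly on Phi, as the size tends to infinity. *)
Definition unif_littleo (R : realType) (T : Type) (Phi : T -> Prop)
    (size : T -> nat) (f g : T -> R) : Prop :=
  forall eps : R, 0 < eps -> exists Q : nat,
    forall t : T, Phi t -> (Q < size t)%N -> `|f t| <= eps * g t.

Section Labels.
Context {R : realType}.
Implicit Types l : nat * R.

(* l \in ({0, ..., K} x R_{>0}) \cup {(0, 0)} *)
Definition is_label (K : nat) l : bool :=
  ((l.1 <= K)%N && (0 < l.2)) || (l == (0%N, 0)).

(* k^(d/N) *)
Definition growth (N d k : nat) : R := k%:R `^ (d%:R / N%:R).

(* count t = mu * (size t)^(d/N) + o((size t)^(d/N)) uniformly on Phi, where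
   l = (d, mu).  For l = (0, 0) this is count t = o(1). *)
Definition unif_asymptotic (N : nat) l (T : Type) (Phi : T -> Prop)
    (size count : T -> nat) : Prop :=
  unif_littleo Phi size
    (fun t => (count t)%:R - l.2 * growth N l.1 (size t))
    (fun t => growth N l.1 (size t)).

End Labels.

Definition asymptotic_class (R : realType) (L : language) (N : nat)
    (C : class L) : Prop :=
  (0 < N)%N /\
  forall (n : nat) (phi : formula L n.+1),
  exists (Dphi : {fset nat * R}) (theta : nat * R -> formula L n),
    [/\ forall l, l \in Dphi -> is_label N l,
        forall (M : member C) (a : n.-tuple M),
          exists! l, l \in Dphi /\ sat (theta l) a
      & forall l, l \in Dphi ->
          unif_asymptotic N l
            (fun p : {M : member C & n.-tuple M} =>
               sat (theta l) (projT2 p))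
            (fun p => struct_card (projT1 p))
            (fun p => count_sat phi (projT2 p))].

Fact flatten_tuple_subproof (T : Type) m r (v : m.-tuple (r.-tuple T)) :
  size (flatten (map (@tval r T) v)) == (m * r)%N.
Proof.
rewrite size_flatten /shape -map_comp sumnE big_map big_tuple.
under eq_bigr do rewrite /= size_tuple.
by rewrite sum_nat_const card_ord.
Qed.

Definition flatten_tuple (T : Type) m r (v : m.-tuple (r.-tuple T)) :
  (m * r).-tuple T := Tuple (flatten_tuple_subproof v).

(* The data of a uniform parameter-interpretation of D in C.  The sorts of L'
   are interpreted like unary relations. *)
Record interpretation_data (L L' : language) (C : class L) (D : class L')
    (r : nat) := InterpretationData {
  alpha : member D -> member C;
  npar : nat;
  par : forall A : member D, npar.-tuple (alpha A);
  dom_fml : formula L (r + npar);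
  eqv_fml : formula L (r + r + npar);
  rel_fml : forall P : lrel L', formula L (arity P * r + npar);
  sort_fml : lsort L' -> formula L (r + npar) }.

Section Interpretation.
Context {L L' : language} {C : class L} {D : class L'} {r : nat}.
Variable I : interpretation_data C D r.
Implicit Types A : member D.

Definition univ A : {set r.-tuple (alpha I A)} :=
  [set u : r.-tuple (alpha I A) | sat (dom_fml I) [tuple of u ++ par I A]]%SET.

Definition eqv A : rel (r.-tuple (alpha I A)) :=
  fun u v => sat (eqv_fml I) [tuple of (u ++ v) ++ par I A].

(* X_A/E_A, as the set of E_A-classes in X_A. *)
Definition quotient_univ A : {set {set r.-tuple (alpha I A)}} :=
  equivalence_partition (@eqv A) (univ A).

Definition sat_rel A (P : lrel L')
    (v : (arity P).-tuple (r.-tuple (alpha I A))) : bool :=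
  sat (rel_fml I P) [tuple of flatten_tuple v ++ par I A].

Definition sat_sort A (s : lsort L') (u : r.-tuple (alpha I A)) : bool :=
  sat (sort_fml I s) [tuple of u ++ par I A].

End Interpretation.

(* quot_iso A : A -> X_A/E_A is an isomorphism; the elements of quot_iso A x are the
   representatives of x. *)
Record interpretation (L L' : language) (C : class L) (D : class L')
    (r : nat) := Interpretation {
  idata :> interpretation_data C D r;
  alpha_inj : injective (alpha idata);
  eqv_equiv : forall A : member D,
    {in univ idata A & &, equivalence_rel (@eqv _ _ _ _ _ idata A)};
  rel_invariant : forall (A : member D) (P : lrel L')
      (v w : (arity P).-tuple (r.-tuple (alpha idata A))),
    (forall j, [&& tnth v j \in univ idata A, tnth w j \in univ idata A
                 & eqv (tnth v j) (tnth w j)]) ->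
    sat_rel v = sat_rel w;
  sort_invariant : forall (A : member D) (s : lsort L')
      (u v : r.-tuple (alpha idata A)),
    u \in univ idata A -> v \in univ idata A -> eqv u v ->
    sat_sort s u = sat_sort s v;
  quot_iso : forall A : member D, A -> {set r.-tuple (alpha idata A)};
  quot_iso_inj : forall A : member D, injective (@quot_iso A);
  quot_iso_im : forall A : member D,
    [set quot_iso x | x : A]%SET = quotient_univ idata A;
  quot_iso_rel : forall (A : member D) (P : lrel L') (b : (arity P).-tuple A)
      (v : (arity P).-tuple (r.-tuple (alpha idata A))),
    (forall j, tnth v j \in quot_iso (tnth b j)) -> holds A P b = sat_rel v;
  quot_iso_sort : forall (A : member D) (s : lsort L') (x : A)
      (u : r.-tuple (alpha idata A)),
    u \in quot_iso x -> (sort_of x == s) = sat_sort s u }.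

Section QuotientPartitions.
Context {R : realType} (N : nat) {L L' : language} {C : class L}
  {D : class L'} {r : nat} (I : interpretation C D r).

Local Notation amb := (alpha I).
Local Notation c := (par I).

Record universe_partition := UniversePartition {
  ulabels : {fset nat * R};
  chi : nat * R -> formula L (npar I);
  ulabelsP : forall l, l \in ulabels -> is_label (N * r) l;
  chi_partition : forall A : member D,
    exists! l, l \in ulabels /\ sat (chi l) (c A);
  chi_asymptotic : forall l, l \in ulabels ->
    unif_asymptotic N l (fun A : member D => sat (chi l) (c A))
      (fun A => struct_card (amb A)) (fun A => struct_card A) }.

Definition EQ (U : universe_partition) : set nat :=
  [set e : nat | (0 < e)%N /\ exists lambda : R,
     [/\ 0 < lambda, (e, lambda) \in ulabels U
       & forall B : nat, exists A : member D,
           sat (chi U (e, lambda)) (c A) /\ (B < struct_card A)%N]].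

(* lcm(EQ U), with lcm(set0) = 1; EQ U is included in {1, ..., N r} because
   its elements are first components of labels. *)
Definition LQ (U : universe_partition) : nat :=
  (\big[lcmn/1]_(e < (N * r).+1 | `[< EQ U e >]) e)%N.

Definition represents (A : member D) m (v : m.-tuple (r.-tuple (amb A)))
    (b : m.-tuple A) : bool :=
  [forall j, tnth v j \in quot_iso I (tnth b j)].

Record counting_partition m (phi : formula L' m.+1) := CountingPartition {
  cidx : finType;
  ctheta : cidx -> formula L (m * r + npar I);
  clabel : cidx -> nat * R;
  clabelP : forall i, is_label (N * r) (clabel i);
  ctheta_partition : forall (A : member D) (v : m.-tuple (r.-tuple (amb A))),
    (forall j, tnth v j \in univ I A) ->
    exists! i, sat (ctheta i) [tuple of flatten_tuple v ++ c A];
  ctheta_asymptotic : forall i,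
    unif_asymptotic N (clabel i)
      (fun p : {A : member D & m.-tuple A} =>
         exists v : m.-tuple (r.-tuple (amb (projT1 p))),
           represents v (projT2 p) /\
           sat (ctheta i) [tuple of flatten_tuple v ++ c (projT1 p)])
      (fun p => struct_card (amb (projT1 p)))
      (fun p => count_sat phi (projT2 p)) }.

Definition profile m (phi : formula L' m.+1) (K : counting_partition phi)
    (A : member D) (b : m.-tuple A) : {set cidx K} :=
  [set i | [exists v : m.-tuple (r.-tuple (amb A)),
     represents v b && sat (ctheta i) [tuple of flatten_tuple v ++ c A]]]%SET.

End QuotientPartitions.

Arguments universe_partition : clear implicits.
Arguments universe_partition R N {L L' C D r} I.
Arguments counting_partition : clear implicits.
Arguments counting_partition R N {L L' C D r} I {m} phi.

(* Main.v *)
(** On a universe cell where [|A| ~ lambda |M|^(e/N)] with [e > 0], one has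
    [|M|^(d/N) ~ (|A|/lambda)^(d/e)], so a count [~ mu |M|^(d/N)] becomes
    [~ mu lambda^(-d/e) |A|^(d/e)], and [e] divides [L_Q].  On an unbounded
    cell, the count being at most [|A|] forces [d <= e]; a cell with [|A|]
    bounded satisfies any asymptotic estimate.  A cell of [D] is the pullback of
    a universe cell intersected with that of a profile [P]; the label of any
    single index of [P] then governs the whole cell. *)

Require Import Defs.
From mathcomp Require Import all_boot all_order all_algebra finmap.
From mathcomp Require Import all_classical all_reals all_analysis.
From mathcomp Require Import ring lra.

Set Implicit Arguments.
Unset Strict Implicit.
Unset Printing Implicit Defensive.

Import Order.TTheory GRing.Theory Num.Theory.
Import numFieldNormedType.Exports.

Local Open Scope ring_scope.

(** * Renaming of variables and finite disjunctions *)

Definition rename_lift n m (s : 'I_n -> 'I_m) (i : 'I_n.+1) : 'I_m.+1 :=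
  if unlift ord0 i is Some j then lift ord0 (s j) else ord0.

(** Serves to read a sentence pulled back from a universe cell as a formula in [m] parameters, along
    the empty map from ['I_0] to ['I_m]. *)
Fixpoint rename (L : language) n (f : formula L n) :
    forall m, ('I_n -> 'I_m) -> formula L m :=
  match f in formula _ n return forall m, ('I_n -> 'I_m) -> formula L m with
  | FBot _ => fun m _ => FBot L m
  | FEq _ i j => fun m s => FEq L (s i) (s j)
  | FSort _ k i => fun m s => FSort k (s i)
  | FRel _ P i => fun m s => FRel (map_tuple s i)
  | FNot _ g => fun m s => FNot (rename g s)
  | FAnd _ g h => fun m s => FAnd (rename g s) (rename h s)
  | FEx _ g => fun m s => FEx (rename g (rename_lift s))
  end.

Lemma sat_rename (L : language) (M : structure L) n (f : formula L n) m
    (s : 'I_n -> 'I_m) (a : m.-tuple M) :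
  sat (rename f s) a = sat f [tuple tnth a (s i) | i < n].
Proof.
elim: f m s a => {n} [n|n i j|n k i|n P i|n f IH|n f IHf g IHg|n f IH] m s a //=.
- by rewrite !tnth_mktuple.
- by rewrite !tnth_mktuple.
- congr (holds _ _ _); apply: eq_from_tnth => j.
  by rewrite !tnth_map tnth_ord_tuple.
- by rewrite IH.
- by rewrite IHf IHg.
- apply: eq_existsb => x; rewrite IH; congr (sat f _).
  apply: eq_from_tnth => i; rewrite tnth_mktuple /rename_lift.
  case: unliftP => [j|] ->; rewrite ?tnth0 // !tnthS.
  by rewrite tnth_mktuple.
Qed.

Definition FOr (L : language) n (f g : formula L n) : formula L n :=
  FNot (FAnd (FNot f) (FNot g)).

Definition FBigOr (L : language) n (T : Type) (s : seq T)
    (f : T -> formula L n) : formula L n :=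
  foldr (fun t g => FOr (f t) g) (FBot L n) s.

Lemma sat_FBigOr (L : language) (M : structure L) n (T : Type) (s : seq T)
    (f : T -> formula L n) (a : n.-tuple M) :
  sat (FBigOr s f) a = has (fun t => sat (f t) a) s.
Proof. by elim: s => //= t s ->; rewrite negb_and !negbK. Qed.

(** * Calculus of uniform asymptotic estimates *)

Section Asymptotics.
Context {R : realType}.

Lemma unif_asymptotic_reindex N (l : nat * R) (S T : Type) (h : S -> T)
    (Phi : S -> Prop) (Psi : T -> Prop) (size count : T -> nat) :
    (forall s, Phi s -> Psi (h s)) ->
    unif_asymptotic N l Psi size count ->
  unif_asymptotic N l Phi (size \o h) (count \o h).
Proof.
move=> sub asy eps /asy[Q asyQ]; exists Q => s /sub Phis; exact: asyQ.
Qed.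

Lemma unif_asymptotic_finite_union N (l : nat * R) (T : Type) (J : finType)
    (Phi : T -> Prop) (Psi : J -> T -> Prop) (size count : T -> nat) :
    (forall t, Phi t -> exists j, Psi j t /\
       unif_asymptotic N l (Psi j) size count) ->
  unif_asymptotic N l Phi size count.
Proof.
move=> cover eps eps0.
(* An index without the estimate gets the default threshold 0; the cover never selects such an
   index, so the maximum of the thresholds works. *)
have bound j : exists Q, unif_asymptotic N l (Psi j) size count ->
    forall t, Psi j t -> (Q < size t)%N ->
    `|(count t)%:R - l.2 * growth N l.1 (size t)| <=
    eps * growth N l.1 (size t).
  have [asy|nasy] := pselect (unif_asymptotic N l (Psi j) size count).
    by have [Q asyQ] := asy _ eps0; exists Q.
  by exists 0%N.
have [Q QP] := choice bound.
exists (\max_j Q j)%N => t /cover[j [Psijt asy]] large.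
apply: (QP j) => //; apply: leq_ltn_trans large; exact: leq_bigmax.
Qed.

Lemma unif_asymptotic_bounded N (l : nat * R) (T : Type) (Phi : T -> Prop)
    (size count : T -> nat) (B : nat) :
  (forall t, Phi t -> (size t <= B)%N) -> unif_asymptotic N l Phi size count.
Proof. by move=> bd eps _; exists B => t /bd; rewrite leqNgt => /negP. Qed.

Lemma powR_continuous_at (p x : R) :
  0 < x -> {for x, continuous (fun y : R => y `^ p)}.
Proof.
move=> x0; apply: differentiable_continuous; apply/derivable1_diffP.
by apply: derivable_powR; rewrite in_itv /= x0.
Qed.

Lemma growth_gt0 N d k : (0 < k)%N -> 0 < growth N d k :> R.
Proof. by move=> k0; rewrite powR_gt0 // ltr0n. Qed.

(** Put [x = m^(e/N)], [u = a/x] and [p = d/e]. Then [u] tends to [lambda], so [a^p = u^p x^p] is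
    close to [lambda^p x^p] by continuity of the power at [lambda > 0], while [c] is close to
    [mu x^p]. The degree is chosen so that [d * (K %/ e) / K = p]. The hypothesis on [B] and [Q]
    turns thresholds on [m] into thresholds on [a]. *)
Lemma unif_asymptotic_rescale N K d e (lambda mu : R) (T : Type)
    (Phi : T -> Prop) (m a c : T -> nat) :
    (0 < N)%N -> (0 < K)%N -> (0 < e)%N -> (e %| K)%N -> 0 < lambda ->
    (forall B, exists Q, forall t, Phi t -> (Q < a t)%N -> (B < m t)%N) ->
    unif_asymptotic N (e, lambda) Phi m a ->
    unif_asymptotic N (d, mu) Phi m c ->
  unif_asymptotic K ((d * (K %/ e))%N, mu * lambda `^ (- (d%:R / e%:R)))
    Phi a c.
Proof.
move=> N0 K0 e0 eK l0 large asya asyc eps eps0 /=.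
set p := d%:R / e%:R.
have P0 : 0 < lambda `^ p by apply: powR_gt0.
set P := lambda `^ p in P0.
set k := mu * lambda `^ (- p).
have k10 : 0 < `|k| + 1 by rewrite ltr_pwDr.
(* The bound [P / 2] keeps [u^p] above [P / 2], so that errors relative to [x^p] become errors
   relative to [a^p]. The other bound makes [|k| |P - u^p|] at most [eps * P / 4], the [+ 1]
   covering [k = 0]. *)
pose eps2 := Num.min (P / 2) (eps * P / 4 / (`|k| + 1)).
have eps20 : 0 < eps2 by rewrite lt_min !divr_gt0 ?mulr_gt0.
have eps1 : 0 < eps * P / 4 by rewrite !divr_gt0 ?mulr_gt0.
have /cvgrPdist_le /(_ _ eps20) /nbhs_ballP[del /= del0 cont] :=
  @powR_continuous_at p _ l0.
(* Half of [del], since the estimate is non-strict and the ball is open. *)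
have [Q1 asyaQ] := asya (del / 2) ltac:(by rewrite divr_gt0).
have [Q2 asycQ] := asyc _ eps1.
have [Q largeQ] := large (maxn Q1 Q2); exists Q => t Pt /(largeQ _ Pt) mt.
have {asyaQ} /= := asyaQ t Pt (leq_ltn_trans (leq_maxl _ _) mt).
have {asycQ} /= := asycQ t Pt (leq_ltn_trans (leq_maxr _ _) mt).
have N0' : N%:R != 0 :> R by rewrite pnatr_eq0 -lt0n.
have e0' : e%:R != 0 :> R by rewrite pnatr_eq0 -lt0n.
have K0' : K%:R != 0 :> R by rewrite pnatr_eq0 -lt0n.
have -> : growth N d (m t) = growth N e (m t) `^ p :> R.
  by rewrite /growth -powRrM /p; congr (_ `^ _); field; apply/andP.
have -> : growth K (d * (K %/ e)) (a t) = (a t)%:R `^ p :> R.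
  rewrite /growth /p; congr (_ `^ _).
  rewrite -{2}(divnK eK) !natrM invfM mulrA mulfK //.
  by apply: contraNneq K0' => z; rewrite -(divnK eK) natrM z mul0r.
have x0 : 0 < growth N e (m t) :> R by rewrite growth_gt0 ?(leq_ltn_trans _ mt).
set x := growth N e (m t) in x0 *.
pose u : R := (a t)%:R / x.
have u0 : 0 <= u by rewrite divr_ge0 // ltW.
have -> : (a t)%:R = u * x by rewrite /u divfK ?gt_eqF.
rewrite powRM ?(ltW x0) //; set y := x `^ p => cbd abd.
have y0 : 0 < y by apply: powR_gt0.
have {}abd : `|lambda - u| <= del / 2.
  rewrite -(ler_pM2r x0) -[X in _ * X <= _]gtr0_norm // -normrM.
  by rewrite mulrBl distrC.
have {}cont : `|P - u `^ p| <= eps2.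
  by apply: cont; rewrite /ball /=; apply: le_lt_trans abd _; lra.
have uP : P / 2 <= u `^ p.
  have : `|P - u `^ p| <= P / 2 by apply: le_trans cont _; rewrite ge_min lexx.
  by move=> /(le_trans (ler_norm _)); lra.
have kP : k * P = mu by rewrite /k /P powRN divfK ?gt_eqF.
have kbd : `|k| * `|P - u `^ p| <= eps * P / 4.
  have h : `|P - u `^ p| <= eps * P / 4 / (`|k| + 1).
    by apply: le_trans cont _; rewrite ge_min lexx orbT.
  apply: (@le_trans _ _ ((`|k| + 1) * (eps * P / 4 / (`|k| + 1)))).
    by rewrite ler_pM // lerDl.
  by rewrite mulrC divfK ?gt_eqF.
(* As [mu = k * P], the error splits into that of the count and that of replacing [P] by [u^p]; each
   is at most [eps * P / 4 * y]. *)
clearbody k; have -> : (c t)%:R - k * (u `^ p * y) =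
    ((c t)%:R - mu * y) + k * (P - u `^ p) * y by rewrite -kP; ring.
apply: (le_trans (ler_normD _ _)); rewrite !normrM (gtr0_norm y0).
apply: (@le_trans _ _ (eps * P / 4 * y + eps * P / 4 * y)).
  by apply: lerD => //; rewrite ler_pM2r.
rewrite -mulrDl [leRHS]mulrA ler_pM2r //.
have : eps * (P / 2) <= eps * u `^ p by rewrite ler_pM2l.
by clear; lra.
Qed.

(** If [d > K], put [q = d/K - 1 > 0]. For large [a] the estimate gives [c >= mu/2 * a * a^q], and
    [c <= a] then forces [a^q <= 2/mu], which bounds [a]. *)
Lemma unif_asymptotic_degree_le K d (mu : R) (T : Type) (Phi : T -> Prop)
    (a c : T -> nat) :
    (0 < K)%N -> 0 < mu -> (forall t, (c t <= a t)%N) ->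
    (forall B, exists t, Phi t /\ (B < a t)%N) ->
    unif_asymptotic K (d, mu) Phi a c ->
  (d <= K)%N.
Proof.
move=> K0 mu0 ca unb asy; rewrite leqNgt; apply/negP => Kd.
have [Q asyQ] := asy (mu / 2) ltac:(by rewrite divr_gt0).
have K0' : 0 < K%:R :> R by rewrite ltr0n.
pose q : R := (d%:R - K%:R) / K%:R.
have q0 : 0 < q by rewrite divr_gt0 // subr_gt0 ltr_nat.
pose b : R := (2 / mu) `^ q^-1.
have [t [Pt]] := unb (maxn Q (Num.bound b)).
rewrite gtn_max => /andP[Qt bt].
have {asyQ} /= := asyQ t Pt Qt.
have at0 : 0 < (a t)%:R :> R by rewrite ltr0n (leq_ltn_trans _ Qt).
have -> : growth K d (a t) = (a t)%:R * (a t)%:R `^ q :> R.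
  rewrite -{1}(powRr1 (ltW at0)) -powRD ?(gt_eqF at0) ?implybT //.
  by rewrite /growth; congr (_ `^ _); rewrite /q; field; rewrite gt_eqF.
rewrite mulrCA distrC => /(le_trans (ler_norm _)).
have : (c t)%:R <= (a t)%:R :> R by rewrite ler_nat.
set z := (a t)%:R `^ q => cat asy'.
have : mu / 2 * z * (a t)%:R <= 1 * (a t)%:R by nra.
rewrite ler_pM2r // => zb.
have {}zb : z <= 2 / mu by rewrite ler_pdivlMr // mulrC; lra.
have atb : (a t)%:R <= b.
  have -> : (a t)%:R = z `^ q^-1.
    by rewrite /z -powRrM mulfV ?gt_eqF // powRr1 // ltW.
  have q1 : 0 <= q^-1 by rewrite invr_ge0 ltW.
  have mu1 : 0 <= 2 / mu by rewrite divr_ge0 // ltW.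
  by apply: ge0_ler_powR; rewrite ?nnegrE ?powR_ge0.
suff : b < (a t)%:R by rewrite ltNge atb.
apply: lt_trans (_ : (Num.bound b)%:R < _); last by rewrite ltr_nat.
by apply: archi_boundP; rewrite powR_ge0.
Qed.

End Asymptotics.

(** * From cells indexed by a finite type to cells indexed by labels *)

Section Cells.
Context {R : realType} {L : language} (N : nat) (C : class L).

(** The cells built on [D] are indexed by a universe label and a profile, whereas an asymptotic
    class has its cells indexed by counting labels; this passes from the first form to the
    second. *)
Lemma finite_cells_definability n (phi : formula L n.+1) (T : finType)
    (cell : T -> formula L n) :
    (forall (M : member C) (a : n.-tuple M), exists! t, sat (cell t) a) ->
    (forall t, exists l : nat * R, is_label N l /\
       unif_asymptotic N l
         (fun p : {M : member C & n.-tuple M} => sat (cell t) (projT2 p))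
         (fun p => struct_card (projT1 p))
         (fun p => count_sat phi (projT2 p))) ->
  exists (Dphi : {fset nat * R}) (theta : nat * R -> formula L n),
    [/\ forall l, l \in Dphi -> is_label N l,
        forall (M : member C) (a : n.-tuple M),
          exists! l, l \in Dphi /\ sat (theta l) a
      & forall l, l \in Dphi ->
          unif_asymptotic N l
            (fun p : {M : member C & n.-tuple M} =>
               sat (theta l) (projT2 p))
            (fun p => struct_card (projT1 p))
            (fun p => count_sat phi (projT2 p))].
Proof.
move=> cellP asy; have [lab labP] := choice asy.
(* Distinct cells may carry the same label, so they are merged. *)
pose theta l := FBigOr [seq t <- enum T | lab t == l] cell.
have sat_theta l (M : member C) (a : n.-tuple M) :
    reflect (exists2 t, lab t = l & sat (cell t) a) (sat (theta l) a).
  rewrite sat_FBigOr; apply: (iffP hasP) => [[t]|[t tl at_]].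
    by rewrite mem_filter => /andP[/eqP tl _] at_; exists t.
  by exists t => //; rewrite mem_filter tl eqxx mem_enum.
exists [fset lab t | t in T]%fset, theta; split.
- by move=> l /imfsetP[t _ ->]; case: (labP t).
- move=> M a; have [t [at_ tuniq]] := cellP M a.
  exists (lab t); split=> [|l [_ /sat_theta[t' <- /tuniq ->]] //].
  by split; [apply/imfsetP; exists t | apply/sat_theta; exists t].
- move=> l _; apply: (@unif_asymptotic_finite_union _ _ _ _ T _
    (fun t p => sat (cell t) (projT2 p))) => -[M a] /sat_theta[t <- at_].
  by exists t; split=> //; case: (labP t).
Qed.

End Cells.

(** * Representatives, and comparison of the sizes of [A] and [alpha I A] *)

Section InterpretationFacts.
Context {L L' : language} {C : class L} {D : class L'} {r : nat}.
Variable I : interpretation C D r.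

Lemma exists_representative (A : member D) (x : A) :
  exists u, u \in quot_iso I x /\ u \in univ I A.
Proof.
have : quot_iso I x \in quotient_univ I A by rewrite -quot_iso_im imset_f.
move=> /imsetP[u uX ->]; exists u; split=> //; rewrite inE uX /=.
by have [] := @eqv_equiv _ _ _ _ _ I A u u u uX uX uX.
Qed.

Lemma card_le_expn (A : member D) :
  (struct_card A <= struct_card (alpha I A) ^ r)%N.
Proof.
rewrite /struct_card -cardsT -(card_imset _ (@quot_iso_inj _ _ _ _ _ I A)).
have -> : quot_iso I (A:=A) @: [set: A] = quotient_univ I A.
  rewrite -quot_iso_im; apply/setP => X.
  by apply/imsetP/imsetP => -[x _ ->]; exists x.
apply: leq_trans (leq_imset_card _ _) _.
by rewrite -card_tuple max_card.
Qed.

(** Since [A] is a quotient of a set of [r]-tuples, an ambient size at most [B] gives [|A| <= B^r].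
    Thresholds on the ambient size can thus be replaced by thresholds on [|A|]. *)
Lemma card_unbounded (B : nat) :
  exists Q, forall A : member D,
    (Q < struct_card A)%N -> (B < struct_card (alpha I A))%N.
Proof.
exists (B ^ r)%N => A; apply: contraTT; rewrite -!leqNgt => MB.
have mono k : (struct_card (alpha I A) ^ k <= B ^ k)%N.
  by elim: k => // k IH; rewrite !expnS leq_mul.
exact: leq_trans (card_le_expn A) (mono r).
Qed.

End InterpretationFacts.

(** * Labels of the cells of [D] *)

Section QuotientCells.
Context {R : realType} {N : nat} {L L' : language} {C : class L}
  {D : class L'} {r : nat} {I : interpretation C D r}.

Lemma LQ_gt0 (U : universe_partition R N I) : (0 < LQ U)%N.
Proof.
rewrite /LQ; elim/big_ind: _ => // [x y x0 y0|e /asboolP[]//].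
by rewrite lcmn_gt0 x0.
Qed.

Lemma dvdn_LQ (U : universe_partition R N I) e : EQ U e -> (e %| LQ U)%N.
Proof.
move=> EQe; have [e0 [lambda [l0 /ulabelsP lab _]]] := EQe.
have eN : (e < (N * r).+1)%N.
  rewrite ltnS; case/orP: lab => [/andP[]//|/eqP[ez]].
  by move: e0; rewrite ez.
by apply: (@biglcmn_sup _ (Ordinal eN)) => //; apply/asboolP.
Qed.

(** For degree 0 the growth is constantly 1, so tolerance 1 gives [|A| <= |lambda| + 1] on all large
    ambient structures, against unboundedness. A positive degree in turn excludes the label
    [(0, 0)]. *)
Lemma unbounded_cell_label (U : universe_partition R N I) l :
    (0 < N)%N -> l \in ulabels U ->
    (forall B : nat, exists A : member D,
       sat (chi U l) (par I A) /\ (B < struct_card A)%N) ->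
  0 < l.2 /\ EQ U l.1.
Proof.
case: l => e lambda N0 lU unb /=.
have e0 : (0 < e)%N.
  rewrite lt0n; apply/negP => /eqP ez.
  have [Q asyQ] := chi_asymptotic lU ltr01.
  have [Q' largeQ] := card_unbounded I Q.
  have [A [chiA]] := unb (maxn Q' (Num.bound (`|lambda| + 1))).
  rewrite gtn_max => /andP[/largeQ MA bA].
  have := asyQ A chiA MA; rewrite /= ez /growth mul0r powRr0 !mulr1.
  move=> /(le_trans (ler_norm _)); rewrite lerBlDl => Ab.
  have : `|lambda| + 1 < (struct_card A)%:R.
    apply: lt_trans (_ : (Num.bound (`|lambda| + 1))%:R < _).
      by apply: archi_boundP; rewrite addr_ge0.
    by rewrite ltr_nat.
  apply/negP; rewrite -leNgt; apply: le_trans Ab _.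
  by rewrite lerD2r ler_norm.
have l0 : 0 < lambda.
  case/orP: (ulabelsP lU) => [/andP[]//|/eqP[ez]].
  by move: e0; rewrite ez.
by split=> //; split=> //; exists lambda; split.
Qed.

Lemma cell_asymptotic (U : universe_partition R N I) m
    (phi : formula L' m.+1) (K : counting_partition R N I phi) l (i : cidx K)
    (Phi : {A : member D & m.-tuple A} -> Prop) :
    (0 < N)%N -> l \in ulabels U ->
    (forall p, Phi p ->
       sat (chi U l) (par I (projT1 p)) /\ i \in profile K (projT2 p)) ->
  exists l' : nat * R, is_label (LQ U) l' /\
    unif_asymptotic (LQ U) l' Phi
      (fun p => struct_card (projT1 p)) (fun p => count_sat phi (projT2 p)).
Proof.
move=> N0 lU PhiP.
have [[B bd]|unb] := pselect (exists B : nat,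
    forall p, Phi p -> (struct_card (projT1 p) <= B)%N).
  exists (0%N, 0); split; first by rewrite /is_label eqxx orbT.
  exact: unif_asymptotic_bounded bd.
have {}unb (B : nat) : exists p, Phi p /\ (B < struct_card (projT1 p))%N.
  apply: contra_notP unb => nB; exists B => p Phip.
  by rewrite leqNgt; apply/negP => Bp; apply: nB; exists p.
have [l20 EQl] : 0 < l.2 /\ EQ U l.1.
  apply: unbounded_cell_label => // B.
  by have [p [/PhiP[chip _] Bp]] := unb B; exists (projT1 p).
have asyU := @unif_asymptotic_reindex R N l _ _ (@projT1 _ _) Phi _ _ _
  (fun p Pp => (PhiP p Pp).1) (chi_asymptotic lU).
have asyK : unif_asymptotic N (clabel i) Phi
    (fun p => struct_card (alpha I (projT1 p)))
    (fun p => count_sat phi (projT2 p)).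
  (* An index of the profile provides one representative tuple satisfying [ctheta i], which is all
     the estimate asks; invariance under change of representatives does not enter. *)
  apply: (@unif_asymptotic_reindex R N _ _ _ id) (ctheta_asymptotic i).
  by move=> p /PhiP[_]; rewrite inE => /existsP[v /andP[? ?]]; exists v.
have large B : exists Q, forall p, Phi p -> (Q < struct_card (projT1 p))%N ->
    (B < struct_card (alpha I (projT1 p)))%N.
  by have [Q largeQ] := card_unbounded I B; exists Q => p _; apply: largeQ.
have [e0 _] := EQl; have eL := dvdn_LQ EQl; have L0 := LQ_gt0 U.
have labi := clabelP i.
case: l lU l20 EQl PhiP asyU e0 eL => e lambda /= lU l20 EQl PhiP asyU e0 eL.
case: (clabel i) labi asyK => d mu labi asyK.
have asy := unif_asymptotic_rescale N0 L0 e0 eL l20 large asyU asyK.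
eexists; split; last exact: asy.
(* For [mu > 0] the degree is bounded because a count in [A] is at most [|A|]. The label [(0, 0)]
   rescales to itself. *)
case/orP: labi => [/= /andP[_ mu0]|/eqP[-> ->]].
  apply/orP; left; rewrite /= mulr_gt0 ?powR_gt0 // andbT.
  apply: (unif_asymptotic_degree_le L0 _ _ unb asy); last first.
    by move=> p; apply: max_card.
  by rewrite mulr_gt0 ?powR_gt0.
by rewrite /is_label mul0n mul0r eqxx orbT.
Qed.

(** Any choice of representatives of the coordinates of [b] falls in some ambient cell. *)
Lemma profile_neq0 m (phi : formula L' m.+1) (K : counting_partition R N I phi)
    (A : member D) (b : m.-tuple A) : profile K b != finset.set0.
Proof.
have [rep repP] := choice (@exists_representative _ _ _ _ _ I A).
pose v := map_tuple rep b.
have vX j : tnth v j \in univ I A by rewrite tnth_map; case: (repP (tnth b j)).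
have [i [vi _]] := @ctheta_partition _ _ _ _ _ _ _ _ _ _ K _ _ vX.
apply/set0Pn; exists i; rewrite inE; apply/existsP; exists v; rewrite vi andbT.
by apply/forallP => j; rewrite tnth_map; case: (repP (tnth b j)).
Qed.

End QuotientCells.

(** * Assembly of the definable cells *)

Theorem corollary8p10 (R : realType) (L L' : language) (N r : nat)
  (C : class L) (D : class L')
  (hr : (0 < r)%N)
  (hC : asymptotic_class R N C)
  (I : interpretation C D r)
  (U : universe_partition R N I)
  (pullback_universe : forall l, l \in ulabels U ->
     exists chi_down : formula L' 0, forall A : member D,
       sat chi_down ([tuple] : 0.-tuple A) <-> sat (chi U l) (par I A))
  (pullback_profile : forall (m : nat) (phi : formula L' m.+1),
     exists K : counting_partition R N I phi,
       forall P : {set cidx K}, (exists i, i \in P) ->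
         exists gamma : formula L' m,
           forall (A : member D) (b : m.-tuple A),
             sat gamma b <-> profile K b = P) :
  asymptotic_class R (LQ U) D.
Proof.
have [N0 _] := hC; split=> [|m phi]; first exact: LQ_gt0.
have [K KP] := pullback_profile m phi.
have /choice[cd cdP] (l : ulabels U) := pullback_universe (val l) (valP l).
have /choice[g gP] (P : {set cidx K}) : exists g : formula L' m,
    forall (A : member D) (b : m.-tuple A), sat g b <-> profile K b = P.
  have [->|/set0Pn/KP//] := eqVneq P finset.set0.
  (* The pullback hypothesis concerns nonempty [P]; the empty set is never a profile, so falsity
     defines it. *)
  exists (FBot L' m) => A b.
  by split=> // /eqP; rewrite (negPf (profile_neq0 K b)).
pose cell (t : ulabels U * {set cidx K}) :=
  FAnd (rename (cd t.1) (widen_ord (leq0n m))) (g t.2).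
have cellP t (A : member D) (b : m.-tuple A) :
    sat (cell t) b <-> sat (chi U (val t.1)) (par I A) /\ profile K b = t.2.
  rewrite /= sat_rename -gP -cdP [X in sat _ X]tuple0.
  by split=> [/andP[]//|[-> ->]].
apply: (@finite_cells_definability R L' (LQ U) D m phi _ cell) => [A b|[l P]].
  have [l [[lU chil] luniq]] := chi_partition U A.
  exists ([` lU]%fset, profile K b); split=> [|[l' P] /cellP[/= chil' <-]].
    exact/cellP.
  congr (_, _); apply: val_inj; apply: luniq; split=> //; exact: valP.
have [P0|/set0Pn[i iP]] := eqVneq P finset.set0.
  (* No parameter tuple has an empty profile, so this cell is empty and any label fits. *)
  exists (0%N, 0); split; first by rewrite /is_label eqxx orbT.
  apply: (@unif_asymptotic_bounded _ _ _ _ _ _ _ 0) => -[A b] /cellP[_ /= /eqP].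
  by rewrite P0 (negPf (profile_neq0 K b)).
apply: (@cell_asymptotic R N _ _ _ _ _ _ U m phi K (val l) i _ N0 (valP l)).
by move=> [A b] /cellP[/= chil ->].
Qed.
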